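(* Let $d=1$ and $\Delta\ell\ge 0$, and let $c\in\mathbb{Z}$ with $|c|\le 2$ be the dimensionless velocity. The flattened weights $(C_{\Delta\ell,m})_{m=-2}^{2}$ of the Lax-Wendroff stream phase are given, for $c\ne 0$, by $$C_{\Delta\ell,0}=-\frac{|c|^2}{2^{\Delta\ell}},\qquad C_{\Delta\ell,-c/|c|}=\frac{|c|}{2}\Big(1+\frac{|c|}{2^{\Delta\ell}}\Big),\qquad C_{\Delta\ell,c/|c|}=-\frac{|c|}{2}\Big(1-\frac{|c|}{2^{\Delta\ell}}\Big),$$ all other weights being zero (for $c=0$ all weights are zero). Therefore, the Lax-Wendroff stream phase matches that of the reference scheme up to order $s=2$, that is, for every $\Delta\ell\ge0$ and every velocity $c\in\mathbb{Z}$ with $|c|\le 2$, $$\sum_{m=-2}^{2}C_{\Delta\ell,m}=0,\qquad \sum_{m=-2}^{2}m\,C_{\Delta\ell,m}=-c,\qquad \sum_{m=-2}^{2}m^2C_{\Delta\ell,m}=\frac{c^2}{2^{\Delta\ell}} .$$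
   Context: Setting ($d=1$). Cells of level $\ell$ are indexed by $k\in\mathbb{Z}$; $\overline{L}$ is the finest level and $\Delta\ell=\overline{L}-\ell\ge 0$. A distribution function moves with dimensionless velocity $c\in\mathbb{Z}$, and one assumes $|c|\le 2$ for all velocities. Let $(f_k)_{k\in\mathbb{Z}}$ be the (post-collision) values at level $\ell$. Lax-Wendroff stream phase: for $c\neq0$ the updated value on the cell $(\ell,k)$ is $$\Big(1-\frac{|c|^2}{4^{\Delta\ell}}\Big)f_k+\frac{|c|}{2^{\Delta\ell+1}}\Big(1+\frac{|c|}{2^{\Delta\ell}}\Big)f_{k-c/|c|}-\frac{|c|}{2^{\Delta\ell+1}}\Big(1-\frac{|c|}{2^{\Delta\ell}}\Big)f_{k+c/|c|},$$ and for $c=0$ it is $f_k$. Flattened weights: the real numbers $(C_{\Delta\ell,m})_{m=-2}^{2}$ (depending on $c$) such that, for all data $(f_k)_k$ and all $k$, the updated value on the cell $(\ell,k)$ equals $$f_k+\frac{1}{2^{\Delta\ell}}\sum_{m=-2}^{2}C_{\Delta\ell,m}\,f_{k+m}.$$ Match: the stream phase matches that of the reference scheme at order $s\ge 1$ if $\sum_{m=-2}^{2}C_{\Delta\ell,m}=0$ and $\sum_{m=-2}^{2}m^pC_{\Delta\ell,m}=\dfrac{(-c)^p}{2^{\Delta\ell(p-1)}}$ for $p=1,\dots,s$, for every $\Delta\ell\ge 0$ and every velocity $c$ of the scheme. *)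

(* Defs.v *)
From mathcomp Require Import all_boot all_order all_algebra.
From mathcomp Require Import reals.

Set Implicit Arguments.
Unset Strict Implicit.
Unset Printing Implicit Defensive.

Import Order.TTheory GRing.Theory Num.Theory.
Local Open Scope ring_scope.

(* Throughout, [dl : nat] is the level gap between the finest level and the
   level of the cells, and [f : int -> R] collects the values on the cells
   [k : int] of that level.  A stream phase maps [dl], a velocity [c], the data
   [f] and a cell [k] to the updated value on [k]. *)
Definition stream_phase (R : realType) := nat -> int -> (int -> R) -> int -> R.

(* For [c != 0] the unit direction [c / |c|] is [sgz c]. *)
Definition lax_wendroff (R : realType) : stream_phase R := fun dl c f k =>
  let a : R := `|c|%:~R in
  if c == 0 then f k else
    (1 - a ^+ 2 / 4 ^+ dl) * f k
    + a / 2 ^+ dl.+1 * (1 + a / 2 ^+ dl) * f (k - sgz c)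
    - a / 2 ^+ dl.+1 * (1 - a / 2 ^+ dl) * f (k + sgz c).

Definition window : seq int := [:: -2; -1; 0; 1; 2].

(* Only the values of [C] on [window] are relevant. *)
Definition flattened_weights (R : realType) (S : stream_phase R)
    (dl : nat) (c : int) (C : int -> R) : Prop :=
  forall (f : int -> R) (k : int),
    S dl c f k = f k + (2 ^+ dl)^-1 * \sum_(m <- window) C m * f (k + m).

(* Matching of a stream phase with that of the reference scheme at order [s],
   for the velocities in [V]. *)
Definition matches_reference (R : realType) (S : stream_phase R)
    (V : pred int) (s : nat) : Prop :=
  forall (dl : nat) (c : int), V c ->
    exists2 C : int -> R, flattened_weights S dl c C &
      \sum_(m <- window) C m = 0
      /\ forall p : nat, (1 <= p <= s)%N ->
           \sum_(m <- window) m%:~R ^+ p * C m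
             = (- c)%:~R ^+ p / 2 ^+ (dl * (p - 1)).

(* Main.v *)
Require Import Defs.
From mathcomp Require Import all_boot all_order all_algebra.
From mathcomp Require Import reals.
From mathcomp Require Import ring.

Import Order.TTheory GRing.Theory Num.Theory.
Local Open Scope ring_scope.

(** The Lax-Wendroff update of a cell is a fixed linear combination of the
    value on the cell and of its two neighbours, so its weights are read off
    from the formula: [lw_weights] is a candidate supported on [0] and
    [+/- sgz c] ([lw_weights_flattened]).  Flattened weights of any stream
    phase are determined on the window, since the data equal to 1 on a single
    cell [m] and to 0 elsewhere isolate the weight of [m]
    ([flattened_weights_unique]); hence every family of flattened weights is
    this candidate.

    The moments then reduce to a three-point sum ([sum_lw_weights]).  With
    [s = sgz c] and [a = |c|], the zeroth moment is
    [- a^2 / 2^dl + a^2 / 2^dl = 0]; in the first one the dissipative parts of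
    the two neighbours cancel and [- s a = - c] is left; in the second one
    their antisymmetric parts cancel and [s^2 a^2 / 2^dl = c^2 / 2^dl] is left. *)

(** The rest velocity is covered as well: [c = 0] makes [|c|] and so every
    branch vanish. *)
Definition lw_weights (R : realType) (dl : nat) (c m : int) : R :=
  let a : R := `|c|%:~R in
  if m == 0 then - (a ^+ 2 / 2 ^+ dl)
  else if m == - sgz c then a / 2 * (1 + a / 2 ^+ dl)
  else if m == sgz c then - (a / 2 * (1 - a / 2 ^+ dl))
  else 0.

Lemma sgz_cases (c : int) : [\/ c = 0, sgz c = 1 | sgz c = -1].
Proof. by case: (sgzP c) => [->|_|_]; [constructor 1|constructor 2|constructor 3]. Qed.

(** At [c = 0] the three points coincide, which is harmless because all three
    coefficients are then zero. *)
Lemma sum_lw_weights (R : realType) (dl : nat) (c : int) (g : int -> R) :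
  let a : R := `|c|%:~R in
  \sum_(m <- window) lw_weights R dl c m * g m =
    - (a ^+ 2 / 2 ^+ dl) * g 0
    + a / 2 * (1 + a / 2 ^+ dl) * g (- sgz c)
    - a / 2 * (1 - a / 2 ^+ dl) * g (sgz c).
Proof.
rewrite /window !big_cons big_nil /lw_weights.
case: (sgz_cases c) => [->|->|->] /=; last 2 first.
- by ring.
- by rewrite opprK; ring.
by rewrite sgz0 normr0 /= mulr0z; ring.
Qed.

Lemma lw_weights_flattened (R : realType) (dl : nat) (c : int) :
  flattened_weights (@lax_wendroff R) dl c (lw_weights R dl c).
Proof.
move=> f k; rewrite (sum_lw_weights R dl c (fun m => f (k + m))).
rewrite /lax_wendroff addr0; case: eqP => [->|_].
  by rewrite normr0 mulr0z; ring.
have pow2_neq0 : (2 : R) ^+ dl != 0 by rewrite expf_neq0 // pnatr_eq0.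
have -> : (4 : R) ^+ dl = 2 ^+ dl * 2 ^+ dl.
  by rewrite -exprMn; congr (_ ^+ _); ring.
by rewrite (exprS (2 : R) dl) /=; field.
Qed.

(** The data supported on the single cell [m], updated on the cell [0], give
    back the weight of [m]. *)
Lemma flattened_weights_unique (R : realType) (S : stream_phase R)
    (dl : nat) (c : int) (C C' : int -> R) :
  flattened_weights S dl c C -> flattened_weights S dl c C' ->
  {in window, C =1 C'}.
Proof.
move=> CP C'P m m_win.
have pick_m (D : int -> R) :
    \sum_(j <- window) D j * (0 + j == m)%:R = D m.
  rewrite (bigD1_seq m) //= add0r eqxx mulr1 big1 ?addr0 // => j /negPf jm.
  by rewrite add0r jm mulr0.
have := CP (fun j => (j == m)%:R) 0; rewrite C'P !pick_m => /addrI.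
by move/mulfI => -> //; rewrite invr_neq0 // expf_neq0 // pnatr_eq0.
Qed.

Lemma moment0_lw_weights (R : realType) (dl : nat) (c : int) :
  \sum_(m <- window) lw_weights R dl c m = 0.
Proof.
under eq_bigr do rewrite -[lw_weights _ _ _ _]mulr1.
rewrite (sum_lw_weights R dl c (fun=> 1)); field.
by rewrite expf_neq0 // pnatr_eq0.
Qed.

Lemma moment1_lw_weights (R : realType) (dl : nat) (c : int) :
  \sum_(m <- window) m%:~R * lw_weights R dl c m = - c%:~R.
Proof.
under eq_bigr do rewrite mulrC.
rewrite (sum_lw_weights R dl c (fun m => m%:~R)) [in RHS](intEsg c) intrM mulrNz mulr0z.
by field; rewrite expf_neq0 // pnatr_eq0.
Qed.

Lemma moment2_lw_weights (R : realType) (dl : nat) (c : int) :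
  \sum_(m <- window) m%:~R ^+ 2 * lw_weights R dl c m = c%:~R ^+ 2 / 2 ^+ dl.
Proof.
under eq_bigr do rewrite mulrC.
rewrite (sum_lw_weights R dl c (fun m => m%:~R ^+ 2)).
rewrite [in RHS](intEsg c) intrM mulrNz mulr0z.
by field; rewrite expf_neq0 // pnatr_eq0.
Qed.

Theorem proposition5p5 (R : realType) :
  (forall (dl : nat) (c : int), `|c| <= 2 ->
     (exists C : int -> R, flattened_weights (@lax_wendroff R) dl c C)
     /\ forall C : int -> R, flattened_weights (@lax_wendroff R) dl c C ->
          (c != 0 ->
             [/\ C 0 = - (`|c|%:~R ^+ 2 / 2 ^+ dl),
                 C (- sgz c) = `|c|%:~R / 2 * (1 + `|c|%:~R / 2 ^+ dl),
                 C (sgz c) = - (`|c|%:~R / 2 * (1 - `|c|%:~R / 2 ^+ dl))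
               & forall m : int, m \in window ->
                   m != 0 -> m != - sgz c -> m != sgz c -> C m = 0])
          /\ (c = 0 -> forall m : int, m \in window -> C m = 0))
  /\ matches_reference (@lax_wendroff R) [pred c : int | `|c| <= 2] 2
  /\ (forall (dl : nat) (c : int), `|c| <= 2 ->
        forall C : int -> R, flattened_weights (@lax_wendroff R) dl c C ->
          [/\ \sum_(m <- window) C m = 0,
              \sum_(m <- window) m%:~R * C m = - c%:~R
            & \sum_(m <- window) m%:~R ^+ 2 * C m = c%:~R ^+ 2 / 2 ^+ dl]).
Proof.
have unique dl c C : flattened_weights (@lax_wendroff R) dl c C ->
    {in window, C =1 lw_weights R dl c}.
  by move=> CP; apply: flattened_weights_unique CP (lw_weights_flattened R dl c).
split; last split.
- move=> dl c _; split.
    by exists (lw_weights R dl c); apply: lw_weights_flattened.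
  move=> C /unique CE; split=> [c_neq0|c0 m m_win].
    have [s_win s_neq0 s_neqN] :
        [/\ sgz c \in window /\ - sgz c \in window, sgz c != 0
          & sgz c != - sgz c].
      by case: (sgz_cases c) c_neq0 => [->|->|->].
    case: s_win => s_win sN_win.
    split=> [|||m m_win m0 mN mP]; rewrite CE // /lw_weights ?eqxx //.
    + by rewrite oppr_eq0 (negPf s_neq0).
    + by rewrite (negPf s_neq0) (negPf s_neqN).
    + by rewrite (negPf m0) (negPf mN) (negPf mP).
  rewrite CE // /lw_weights c0 sgz0 oppr0 normr0 mulr0z.
  by case: eqP => // _; rewrite expr0n /= mul0r oppr0.
- move=> dl c _; exists (lw_weights R dl c); first exact: lw_weights_flattened.
  split=> [|[|[|[|p]]] //]; first exact: moment0_lw_weights.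
    by rewrite muln0 expr0 divr1 mulrNz => _; apply: moment1_lw_weights.
  by rewrite muln1 mulrNz sqrrN => _; apply: moment2_lw_weights.
- move=> dl c _ C /unique CE; split.
  + by rewrite (eq_big_seq _ CE) moment0_lw_weights.
  + rewrite -(moment1_lw_weights R dl).
    by apply: eq_big_seq => m /CE ->.
  + rewrite -moment2_lw_weights.
    by apply: eq_big_seq => m /CE ->.
Qed.
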